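(* Let $R>0$, $k>0$ and $\omega=(\omega_1,\omega_2)\in S^1$, and put $\omega^\perp=(\omega_2,-\omega_1)$. Let $\beta_0$ be the unique positive solution of the equation $$\frac{2}{e}s+\log s=0.$$ Let $\beta$ satisfy $0<\beta<\beta_0$. Let $\{\tau(N)\}_{N=1,2,\ldots}$ be an arbitrary sequence of positive numbers satisfying, as $N\to\infty$, $$\tau(N)=\frac{\beta N}{eR}+O(1).$$ Then, as $N\to\infty$, $$e^{R\tau(N)}\sup_{|y|\le R}\left|\int_{S^1}e^{iky\cdot\varphi}g_N(\varphi;\tau(N),k,\omega)\,d\sigma(\varphi)-e^{y\cdot(\tau(N)\omega+i\sqrt{\tau(N)^2+k^2}\,\omega^\perp)}\right|$$ $$+\,e^{R\tau(N)}\sup_{|y|\le R}\left|\nabla\left\{\int_{S^1}e^{iky\cdot\varphi}g_N(\varphi;\tau(N),k,\omega)\,d\sigma(\varphi)-e^{y\cdot(\tau(N)\omega+i\sqrt{\tau(N)^2+k^2}\,\omega^\perp)}\right\}\right|=O(N^{-\infty}).$$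
   Context: Points $\vartheta=(\vartheta_1,\vartheta_2)\in S^1$ are identified with the complex numbers $\vartheta_1+i\vartheta_2$, denoted by the same symbol. For $N=1,2,\ldots$, $\tau>0$, $\omega\in S^1$, $k>0$, $$g_N(\varphi;\tau,k,\omega)=\frac1{2\pi}\sum_{|m|\le N}\left\{\frac{ik\varphi}{(\tau+\sqrt{\tau^2+k^2})\,\omega}\right\}^m,\qquad \varphi\in S^1,$$ where the sum is over integers $m$ and $\varphi,\omega$ are regarded as complex numbers. $d\sigma$ is arc length measure on $S^1$; $y\in\mathbf{R}^2$ and the gradient is in $y$. $O(N^{-\infty})$ means $O(N^{-M})$ for every $M>0$. *)

(* Defs.v *)
From Stdlib Require Import Reals Lra ZArith.
From Coquelicot Require Export Coquelicot.
Open Scope R_scope.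

(* Throughout, [C = R * R] serves both as the complex numbers and as R^2, so
   that [Cmod] is the Euclidean norm and S^1 is [Cmod z = 1]. *)

Definition perp (w : C) : C := (snd w, - fst w).

Definition dot (y z : R * R) : R := fst y * fst z + snd y * snd z.

(* The bilinear (not Hermitian) product of y in R^2 with a vector of C^2. *)
Definition cdot (y : R * R) (z : C * C) : C :=
  (RtoC (fst y) * fst z + RtoC (snd y) * snd z)%C.

Definition Cexp (z : C) : C :=
  (exp (Re z) * cos (Im z), exp (Re z) * sin (Im z)).

Definition CpowZ (z : C) (m : Z) : C :=
  match m with
  | Z0 => RtoC 1
  | Zpos p => Cpow z (Pos.to_nat p)
  | Zneg p => Cinv (Cpow z (Pos.to_nat p))
  end.

(* [2 N + 1] terms: [sum_n] includes its upper index, and [j - N] runs over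
   the integers from [-N] to [N]. *)
Definition sum_sym (N : nat) (a : Z -> C) : C :=
  sum_n (fun j => a (Z.of_nat j - Z.of_nat N)%Z) (2 * N).

(* Arc length on S^1 through the unit-speed parametrization; [RInt] is total,
   and is the integral for continuous [f]. *)
Definition circle_int (f : C -> C) : C :=
  RInt (V := C_R_CompleteNormedModule)
       (fun t => f (cos t, sin t)) 0 (2 * PI).

Definition herglotz_density (N : nat) (phi : C) (tau k : R) (omega : C) : C :=
  (RtoC (/ (2 * PI)) *
   sum_sym N (fun m =>
     CpowZ ((Ci * RtoC k * phi) /
            (RtoC (tau + sqrt (tau ^ 2 + k ^ 2)) * omega)) m))%C.

Definition herglotz (N : nat) (tau k : R) (omega : C) (y : R * R) : C :=
  circle_int (fun phi =>
    Cexp (Ci * RtoC (k * dot y phi)) * herglotz_density N phi tau k omega)%C.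

(* The vector tau omega + i sqrt (tau^2 + k^2) omega^perp of C^2. *)
Definition zeta (tau k : R) (omega : C) : C * C :=
  let s := sqrt (tau ^ 2 + k ^ 2) in
  ((RtoC (tau * fst omega) + Ci * RtoC (s * fst (perp omega)))%C,
   (RtoC (tau * snd omega) + Ci * RtoC (s * snd (perp omega)))%C).

Definition approx_error (N : nat) (tau k : R) (omega : C) (y : R * R) : C :=
  (herglotz N tau k omega y - Cexp (cdot y (zeta tau k omega)))%C.

(* [Derive] is total, and is the derivative where it exists; [grad] is applied
   only to smooth functions. *)
Definition CDerive (f : R -> C) (x : R) : C :=
  (Derive (fun t => Re (f t)) x, Derive (fun t => Im (f t)) x).

Definition grad (f : R * R -> C) (y : R * R) : C * C :=
  (CDerive (fun t => f (t, snd y)) (fst y),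
   CDerive (fun t => f (fst y, t)) (snd y)).

Definition C2norm (v : C * C) : R := sqrt (Cmod (fst v) ^ 2 + Cmod (snd v) ^ 2).

(* Valued in [Rbar], so that an unbounded [f] has supremum [p_infty]. *)
Definition sup_disc (rad : R) (f : R * R -> R) : Rbar :=
  Lub_Rbar (fun v => exists y : R * R, Cmod y <= rad /\ v = f y).

Definition bigO (u : nat -> Rbar) (v : nat -> R) : Prop :=
  exists A : R,
    eventually (fun N => Rbar_le (Rbar_abs (u N)) (Finite (A * Rabs (v N)))).

Definition bigO_Ninfty (u : nat -> Rbar) : Prop :=
  forall M : R, 0 < M -> bigO u (fun N => Rpower (INR N) (- M)).

Definition is_beta0 (s : R) : Prop := 0 < s /\ 2 / exp 1 * s + ln s = 0.

Lemma is_beta0_exists_unique : exists! s : R, is_beta0 s.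
Proof.
assert (he : 0 < exp 1) by apply exp_pos.
assert (he2 : 2 < exp 1) by (generalize (exp_ineq1 1); lra).
assert (hc : 0 < 2 / exp 1) by (apply Rdiv_lt_0_compat; lra).
assert (hmono : forall a b, 0 < a -> a < b ->
          2 / exp 1 * a + ln a < 2 / exp 1 * b + ln b).
{ intros a b ha hab. apply Rplus_lt_compat.
  - now apply Rmult_lt_compat_l.
  - now apply ln_increasing. }
assert (hi : / exp 1 < 1) by (apply Rmult_lt_reg_r with (exp 1); [lra | rewrite Rinv_l; lra]).
assert (hi0 : 0 < / exp 1) by now apply Rinv_0_lt_compat.
assert (hi2 : / exp 1 < / 2) by (apply Rinv_lt_contravar; lra).
assert (hroot : exists s, is_beta0 s).
{ destruct (Ranalysis5.IVT_interv (fun s => 2 / exp 1 * s + ln s) (/ exp 1) 1)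
    as [s [hs hs0]].
  - intros a ha. apply continuity_pt_filterlim.
    apply (ex_derive_continuous (fun s => 2 / exp 1 * s + ln s)).
    auto_derive; lra.
  - exact hi.
  - cbv beta; rewrite ln_Rinv, ln_exp by exact he. unfold Rdiv.
    set (x := / exp 1) in *. nra.
  - rewrite ln_1. lra.
  - exists s. split; [lra | exact hs0]. }
destruct hroot as [s [hs hs0]]. exists s. split; [now split|].
intros t [ht ht0].
destruct (Rtotal_order s t) as [h | [h | h]]; [| exact h |].
- generalize (hmono s t hs h). lra.
- generalize (hmono t s ht h). lra.
Qed.

(* Main.v *)
Require Import Defs.
From Stdlib Require Import Reals Lra Lia ZArith Psatz.
From Coquelicot Require Import Coquelicot.
Open Scope R_scope.

(** Write s = sqrt (tau^2 + k^2), w = i k / ((tau + s) omega), and read y as a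
    complex number.  On the circle, i k y.phi = u + v with
    u = (i k y / 2) / phi and v = (i k conj(y) / 2) phi, so the plane wave is the
    double series of u^a v^b / (a! b!), whose terms are characters of frequency
    b - a.  The density is a truncated geometric sum, and integrating against it
    sends phi^n to w^(-n) if |n| <= N and to 0 otherwise
    ([circle_int_density]).  Without the truncation the result would be the plane
    wave evaluated at phi = 1 / w, which is exactly exp (y.zeta)
    ([exponent_eq]); the error is therefore the part |a - b| > N of the series of
    exp (p) exp (q), where p and q are the values of u and v at phi = 1 / w.

    Since a + b > N in that part, for every lam >= 1 its size is at most
    lam^(-N) exp (lam (|p| + |q|)) ([circle_int_Ctaylor] for Taylor polynomials,
    [circle_int_Cexp] in the limit).  Here |p| + |q| = |y| s
    ([exponent_size]), and s <= tau + k.  A derivative in y multiplies the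
    integrand by a combination of phi and 1 / phi, so the components of the
    gradient are treated by the same estimate with the frequencies shifted by 1
    ([grad_approx_error], [approx_error_bounds]).

    With lam = e / beta and rad * tau = beta N / e + O(1), the product of the bound
    with exp (rad * tau) is O(N) times exp (N (beta / e + log beta))
    ([weighted_bound_decay]), and beta / e + log beta is negative because
    0 < beta < beta0 ([decay_rate]). *)

(** * Unit complex numbers, integer powers and the complex exponential *)

Lemma C_ext (a b : C) : fst a = fst b -> snd a = snd b -> a = b.
Proof. destruct a, b; simpl; intros; subst; reflexivity. Qed.

Definition cis (t : R) : C := (cos t, sin t).

Lemma cis_plus s t : cis (s + t) = (cis s * cis t)%C.
Proof. apply C_ext; unfold cis; simpl; [rewrite cos_plus | rewrite sin_plus]; ring. Qed.

Lemma cis_0 : cis 0 = RtoC 1.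
Proof. unfold cis; rewrite cos_0, sin_0; reflexivity. Qed.

Lemma Cmod_cis t : Cmod (cis t) = 1.
Proof.
unfold Cmod, cis; simpl. rewrite !Rmult_1_r.
replace (cos t * cos t + sin t * sin t) with (Rsqr (sin t) + Rsqr (cos t))
  by (unfold Rsqr; ring).
now rewrite sin2_cos2, sqrt_1.
Qed.

Lemma cis_neq_0 t : cis t <> RtoC 0.
Proof. apply Cmod_gt_0. rewrite Cmod_cis. lra. Qed.

Lemma Cinv_cis t : Cinv (cis t) = cis (- t).
Proof.
assert (h : (cis t * cis (- t))%C = RtoC 1).
{ rewrite <- cis_plus, Rplus_opp_r. apply cis_0. }
rewrite <- (Cmult_1_l (cis (- t))), <- (Cinv_l (cis t)), <- Cmult_assoc, h.
- now rewrite Cmult_1_r.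
- apply cis_neq_0.
Qed.

Lemma Cpow_cis t n : (cis t ^ n)%C = cis (INR n * t).
Proof.
induction n as [|n IH].
- simpl. now rewrite Rmult_0_l, cis_0.
- rewrite Cpow_S, IH, <- cis_plus, S_INR. f_equal. ring.
Qed.

Lemma CpowZ_succ (w : C) (m : Z) : w <> RtoC 0 ->
  CpowZ w (m + 1) = (w * CpowZ w m)%C.
Proof.
intros hw. destruct m as [|p|p].
- simpl. ring.
- simpl. rewrite Pos2Nat.inj_add, Nat.add_1_r. now rewrite Cpow_S.
- destruct (Pos.eq_dec p 1) as [->|hp].
  + simpl. field. exact hw.
  + replace (Z.neg p + 1)%Z with (Z.neg (Pos.pred p)) by lia.
    simpl. rewrite <- (Pos.succ_pred p) at 2 by exact hp.
    rewrite Pos2Nat.inj_succ, Cpow_S.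
    field. split; [apply Cpow_nz|]; exact hw.
Qed.

Lemma CpowZ_add_nat (w : C) (m : Z) (n : nat) : w <> RtoC 0 ->
  CpowZ w (m + Z.of_nat n) = (CpowZ w m * w ^ n)%C.
Proof.
intros hw. induction n as [|n IH].
- rewrite Z.add_0_r. simpl. ring.
- rewrite Nat2Z.inj_succ, <- Z.add_1_r, Z.add_assoc, CpowZ_succ, IH, Cpow_S by exact hw.
  ring.
Qed.

Lemma CpowZ_sub_nat (w : C) (m : Z) (n : nat) : w <> RtoC 0 ->
  CpowZ w (m - Z.of_nat n) = (CpowZ w m * (/ w) ^ n)%C.
Proof.
intros hw.
replace (CpowZ w m) with (CpowZ w (m - Z.of_nat n) * w ^ n)%C.
- rewrite <- Cmult_assoc, <- Cpow_mult_l, Cinv_r, Cpow_1_l by exact hw. ring.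
- rewrite <- CpowZ_add_nat by exact hw. f_equal. ring.
Qed.

Lemma CpowZ_mult_cis (w : C) (t : R) (m : Z) : w <> RtoC 0 ->
  CpowZ (w * cis t) m = (CpowZ w m * cis (IZR m * t))%C.
Proof.
intros hw. destruct m as [|p|p]; simpl.
- rewrite Rmult_0_l, cis_0. ring.
- rewrite Cpow_mult_l, Cpow_cis, INR_IZR_INZ, positive_nat_Z. reflexivity.
- rewrite Cpow_mult_l, Cpow_cis, INR_IZR_INZ, positive_nat_Z.
  replace (IZR (Z.neg p) * t) with (- (IZR (Z.pos p) * t))
    by (change (Z.neg p) with (- Z.pos p)%Z; rewrite opp_IZR; ring).
  rewrite <- Cinv_cis. field. split; [apply cis_neq_0 | now apply Cpow_nz].
Qed.

Lemma Cexp_plus (a b : C) : Cexp (a + b) = (Cexp a * Cexp b)%C.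
Proof.
apply C_ext; unfold Cexp, Re, Im; simpl; rewrite exp_plus;
  [rewrite cos_plus | rewrite sin_plus]; ring.
Qed.

Lemma Cmod_Cexp (a : C) : Cmod (Cexp a) = exp (Re a).
Proof.
replace (Cexp a) with (RtoC (exp (Re a)) * cis (Im a))%C.
- rewrite Cmod_mult, Cmod_cis, Cmod_R, Rabs_pos_eq; [ring | left; apply exp_pos].
- apply C_ext; unfold Cexp, cis; simpl; ring.
Qed.

Lemma exp_le_mono x y : x <= y -> exp x <= exp y.
Proof. intros [h|h]; [left; now apply exp_increasing | rewrite h; apply Rle_refl]. Qed.

Lemma Cmod_Cexp_le (a : C) : Cmod (Cexp a) <= exp (Cmod a).
Proof.
rewrite Cmod_Cexp. apply exp_le_mono.
eapply Rle_trans; [apply Rle_abs | apply re_le_Cmod].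
Qed.

(** * Finite sums of complex numbers *)

(** The type of a [sum_n] is presented as the carrier of a monoid structure,
    where [ring] does not recognize the field operations; the tactic brings an
    equation back to [C]. *)
Ltac Ceq := match goal with |- ?a = ?b => change (@eq C a b) end.
Ltac Cring := Ceq; ring.

Lemma Csum_Sn (u : nat -> C) n : sum_n u (S n) = (sum_n u n + u (S n))%C.
Proof. exact (@sum_Sn C_AbelianMonoid u n). Qed.

Lemma Csum_O (u : nat -> C) : sum_n u 0 = u 0%nat.
Proof. exact (@sum_O C_AbelianMonoid u). Qed.

Lemma Cmod_sum_n (u : nat -> C) n : Cmod (sum_n u n) <= sum_f_R0 (fun a => Cmod (u a)) n.
Proof.
induction n as [|n IH].
- rewrite Csum_O. apply Rle_refl.
- rewrite Csum_Sn. simpl. eapply Rle_trans; [apply Cmod_triangle|].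
  now apply Rplus_le_compat_r.
Qed.

Lemma Csum_ext (u v : nat -> C) n : (forall a, u a = v a) -> sum_n u n = sum_n v n.
Proof. intros h. now apply (sum_n_ext (G := C_AbelianMonoid)). Qed.

Lemma Csum_scal c (u : nat -> C) n : sum_n (fun a => c * u a)%C n = (c * sum_n u n)%C.
Proof.
induction n as [|n IH].
- now rewrite !Csum_O.
- rewrite !Csum_Sn, IH. Cring.
Qed.

Lemma Csum_minus (u v : nat -> C) n :
  (sum_n u n - sum_n v n)%C = sum_n (fun a => u a - v a)%C n.
Proof.
induction n as [|n IH].
- now rewrite !Csum_O.
- rewrite !Csum_Sn, <- IH. Cring.
Qed.

Lemma Csum_mult (u v : nat -> C) n m :
  (sum_n u n * sum_n v m)%C = sum_n (fun a => sum_n (fun b => u a * v b)%C m) n.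
Proof.
rewrite Cmult_comm, <- Csum_scal. apply Csum_ext. intros a.
rewrite Csum_scal. Cring.
Qed.

Lemma Csum_single (u : nat -> C) n j : (forall i, i <> j -> u i = RtoC 0) ->
  sum_n u n = if le_dec j n then u j else RtoC 0.
Proof.
intros h. induction n as [|n IH].
- rewrite Csum_O. destruct (le_dec j 0) as [hj|hj].
  + now replace j with 0%nat by lia.
  + apply h. lia.
- rewrite Csum_Sn, IH.
  destruct (le_dec j n) as [h1|h1], (le_dec j (S n)) as [h2|h2]; try lia.
  + rewrite (h (S n)) by lia. Cring.
  + replace j with (S n) by lia. Cring.
  + rewrite (h (S n)) by lia. Cring.
Qed.

Lemma sum_f_R0_prod (u v : nat -> R) n m :
  sum_f_R0 (fun a => sum_f_R0 (fun b => u a * v b) m) n = sum_f_R0 u n * sum_f_R0 v m.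
Proof.
rewrite Rmult_comm, scal_sum. apply sum_eq. intros a _.
rewrite scal_sum. apply sum_eq. intros; ring.
Qed.

(** * The Taylor polynomials of the exponential *)

Definition Ctaylor (M : nat) (z : C) : C :=
  sum_n (fun a => z ^ a * RtoC (/ INR (fact a)))%C M.

Lemma Cmod_taylor_term (z : C) a :
  Cmod (z ^ a * RtoC (/ INR (fact a))) = Cmod z ^ a / INR (fact a).
Proof.
rewrite Cmod_mult, Cmod_pow, Cmod_R, Rabs_pos_eq; [reflexivity|].
left. apply Rinv_0_lt_compat, INR_fact_lt_0.
Qed.

Lemma Cmod_Ctaylor_le M z : Cmod (Ctaylor M z) <= exp (Cmod z).
Proof.
eapply Rle_trans; [apply Cmod_sum_n|].
rewrite (sum_eq _ (fun a => Cmod z ^ a / INR (fact a))).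
- apply exp_ge_taylor, Cmod_ge_0.
- intros; apply Cmod_taylor_term.
Qed.

(** Derivatives are handled through their real and imaginary parts, which is the
    form in which [CDerive] takes them. *)
Definition is_Cderive (f : R -> C) (t : R) (l : C) : Prop :=
  is_derive (fun s => Re (f s)) t (Re l) /\ is_derive (fun s => Im (f s)) t (Im l).

Lemma is_Cderive_eq f t l l' : is_Cderive f t l -> l = l' -> is_Cderive f t l'.
Proof. now intros h <-. Qed.

Lemma is_Cderive_ext f g t l : (forall s, f s = g s) ->
  is_Cderive f t l -> is_Cderive g t l.
Proof.
intros h [h1 h2]. split; (eapply is_derive_ext; [intros s; rewrite <- h; reflexivity|]); assumption.
Qed.

Lemma is_Cderive_mult f g t df dg : is_Cderive f t df -> is_Cderive g t dg ->
  is_Cderive (fun s => f s * g s)%C t (df * g t + f t * dg)%C.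
Proof.
intros [f1 f2] [g1 g2]. split.
- apply (is_derive_ext (fun s => Re (f s) * Re (g s) - Im (f s) * Im (g s))).
  + intros; reflexivity.
  + replace (Re (df * g t + f t * dg)%C) with
      ((Re df * Re (g t) + Re (f t) * Re dg) - (Im df * Im (g t) + Im (f t) * Im dg))
      by (unfold Re, Im; simpl; ring).
    apply (is_derive_minus (V := R_NormedModule)); apply (is_derive_mult (K := R_AbsRing)); auto; intros; apply Rmult_comm.
- apply (is_derive_ext (fun s => Re (f s) * Im (g s) + Im (f s) * Re (g s))).
  + intros; reflexivity.
  + replace (Im (df * g t + f t * dg)%C) with
      ((Re df * Im (g t) + Re (f t) * Im dg) + (Im df * Re (g t) + Im (f t) * Re dg))
      by (unfold Re, Im; simpl; ring).
    apply (is_derive_plus (V := R_NormedModule)); apply (is_derive_mult (K := R_AbsRing)); auto; intros; apply Rmult_comm.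
Qed.

Lemma is_Cderive_plus f g t df dg : is_Cderive f t df -> is_Cderive g t dg ->
  is_Cderive (fun s => f s + g s)%C t (df + dg)%C.
Proof. intros [f1 f2] [g1 g2]. split; apply (is_derive_plus (V := R_NormedModule)); assumption. Qed.

Lemma is_Cderive_minus f g t df dg : is_Cderive f t df -> is_Cderive g t dg ->
  is_Cderive (fun s => f s - g s)%C t (df - dg)%C.
Proof. intros [f1 f2] [g1 g2]. split; apply (is_derive_minus (V := R_NormedModule)); assumption. Qed.

Lemma is_Cderive_const c t : is_Cderive (fun _ => c) t (RtoC 0).
Proof. split; apply (is_derive_const (V := R_NormedModule)). Qed.

Lemma is_Cderive_exp_affine (a z : C) t :
  is_Cderive (fun s => Cexp (a + RtoC s * z))%C t (z * Cexp (a + RtoC t * z))%C.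
Proof.
destruct a as [a1 a2], z as [z1 z2].
apply is_Cderive_ext with (f := fun s => (exp (a1 + s * z1) * cos (a2 + s * z2),
  exp (a1 + s * z1) * sin (a2 + s * z2))).
- intros s. apply C_ext; unfold Cexp, Re, Im; simpl;
    now rewrite !Rmult_0_l, Rminus_0_r, Rplus_0_r.
- split; unfold Cexp, Re, Im; simpl; auto_derive; trivial;
    rewrite !Rmult_0_l, Rminus_0_r, Rplus_0_r; ring.
Qed.

Lemma Cmod_le_Re_Im (z : C) : Cmod z <= Rabs (Re z) + Rabs (Im z).
Proof.
replace z with (RtoC (Re z) + Ci * RtoC (Im z))%C at 1.
- eapply Rle_trans; [apply Cmod_triangle|].
  rewrite Cmod_mult, Cmod_Ci, !Cmod_R. lra.
- apply C_ext; simpl; unfold Re, Im; ring.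
Qed.

Lemma Im_le_Cmod (z : C) : Rabs (Im z) <= Cmod z.
Proof. eapply Rle_trans; [apply Rmax_r | apply Rmax_Cmod]. Qed.

Lemma is_Cderive_taylor M (z : C) t :
  is_Cderive (fun s => Ctaylor (S M) (RtoC s * z)) t (z * Ctaylor M (RtoC t * z))%C.
Proof.
assert (hpow : forall n, is_Cderive (fun s => (RtoC s * z) ^ S n)%C t
          (RtoC (INR (S n)) * z * (RtoC t * z) ^ n)%C).
{ assert (h1 : is_Cderive (fun s => (RtoC s * z)%C) t z).
  { split; unfold Re, Im; simpl; auto_derive; trivial; ring. }
  induction n as [|n IH].
  - apply (is_Cderive_eq _ _ (z * RtoC 1 + (RtoC t * z) * RtoC 0)%C).
    + apply (is_Cderive_mult (fun s => RtoC s * z)%C (fun _ => RtoC 1)); [exact h1|].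
      apply is_Cderive_const.
    + simpl. ring.
  - eapply is_Cderive_eq.
    + apply (is_Cderive_mult (fun s => RtoC s * z)%C (fun s => (RtoC s * z) ^ S n)%C);
        [exact h1 | exact IH].
    + cbv beta. rewrite (S_INR (S n)), RtoC_plus, !Cpow_S. ring. }
induction M as [|M IH].
- eapply is_Cderive_ext; [intros s; symmetry; unfold Ctaylor; rewrite Csum_Sn, Csum_O; reflexivity|].
  eapply is_Cderive_eq.
  + apply (is_Cderive_plus (fun s => RtoC 1 * RtoC (/ INR (fact 0)))%C
      (fun s => (RtoC s * z) ^ 1 * RtoC (/ INR (fact 1)))%C).
    * apply is_Cderive_const.
    * apply (is_Cderive_mult (fun s => (RtoC s * z) ^ 1)%C (fun _ => RtoC (/ INR (fact 1))));
        [apply hpow | apply is_Cderive_const].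
  + unfold Ctaylor. rewrite Csum_O. simpl. ring.
- eapply is_Cderive_ext; [intros s; symmetry; apply Csum_Sn|].
  eapply is_Cderive_eq.
  + apply (is_Cderive_plus (fun s => Ctaylor (S M) (RtoC s * z))
      (fun s => (RtoC s * z) ^ S (S M) * RtoC (/ INR (fact (S (S M)))))%C); [exact IH|].
    apply (is_Cderive_mult (fun s => (RtoC s * z) ^ S (S M))%C
       (fun _ => RtoC (/ INR (fact (S (S M)))))); [apply hpow | apply is_Cderive_const].
  + unfold Ctaylor at 2. rewrite Csum_Sn. fold (Ctaylor M (RtoC t * z)).
    replace (/ INR (fact (S M))) with (INR (S (S M)) * / INR (fact (S (S M)))).
    * rewrite RtoC_mult. ring.
    * rewrite (fact_simpl (S M)), mult_INR. field.
      split; [apply INR_fact_neq_0 | apply not_0_INR; lia].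
Qed.

(** The mean value theorem fails for complex values, but holds for each
    coordinate; adding the two coordinates costs the factor 2. *)
Lemma Cmod_increment_le (f df : R -> C) (D : R) :
  (forall t, 0 <= t <= 1 -> is_Cderive f t (df t) /\ Cmod (df t) <= D) ->
  Cmod (f 1 - f 0) <= 2 * D.
Proof.
intros h.
assert (hmvt : forall g dg : R -> R,
  (forall t, 0 <= t <= 1 -> is_derive g t (dg t) /\ Rabs (dg t) <= D) ->
  Rabs (g 1 - g 0) <= D).
{ intros g dg hg.
  destruct (MVT_gen g 0 1 dg) as [c [hc heq]].
  - intros x hx. rewrite Rmin_left, Rmax_right in hx by lra. apply hg; lra.
  - intros x hx. rewrite Rmin_left, Rmax_right in hx by lra.
    apply continuity_pt_filterlim, (ex_derive_continuous (V := R_NormedModule)).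
    exists (dg x). apply hg; lra.
  - rewrite Rmin_left, Rmax_right in hc by lra.
    rewrite heq, Rminus_0_r, Rmult_1_r. apply hg; lra. }
eapply Rle_trans; [apply Cmod_le_Re_Im|].
assert (h1 : Rabs (Re (f 1 - f 0)%C) <= D).
{ apply (hmvt (fun s => Re (f s)) (fun s => Re (df s))).
  intros t ht. destruct (h t ht) as [[h1 h2] h3]. split; [exact h1|].
  eapply Rle_trans; [apply re_le_Cmod | exact h3]. }
assert (h2 : Rabs (Im (f 1 - f 0)%C) <= D).
{ apply (hmvt (fun s => Im (f s)) (fun s => Im (df s))).
  intros t ht. destruct (h t ht) as [[h2 h2'] h3]. split; [exact h2'|].
  eapply Rle_trans; [apply Im_le_Cmod | exact h3]. }
lra.
Qed.

Lemma Cmod_scal_le t z : 0 <= t <= 1 -> Cmod (RtoC t * z) <= Cmod z.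
Proof.
intros ht. rewrite Cmod_mult, Cmod_R, Rabs_pos_eq by lra.
generalize (Cmod_ge_0 z). nra.
Qed.

Definition taylor_err (M : nat) (x : R) : R :=
  2 * (exp x * exp x) * (x * (x ^ M / INR (fact M))).

Lemma Cexp_0 : Cexp (RtoC 0) = RtoC 1.
Proof. apply C_ext; unfold Cexp; simpl; rewrite exp_0, ?cos_0, ?sin_0; ring. Qed.

Lemma Ctaylor_0 M : Ctaylor M (RtoC 0) = RtoC 1.
Proof.
unfold Ctaylor. induction M as [|M IH].
- rewrite Csum_O. simpl. rewrite Rinv_1. ring.
- rewrite Csum_Sn, IH, Cpow_S. ring.
Qed.

(** The function s -> exp(-sz) T(sz), with T the Taylor polynomial, starts at 1,
    and in its derivative all the terms of T but the last cancel; so its total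
    variation on [0, 1] is controlled by one term of the exponential series. *)
Lemma Ctaylor_remainder M z :
  Cmod (Cexp z - Ctaylor (S M) z) <= taylor_err (S M) (Cmod z).
Proof.
set (T := fun s : R => Ctaylor (S M) (RtoC s * z)).
set (E := fun s : R => Cexp (RtoC 0 + RtoC s * - z)%C).
set (dH := fun t : R => (- (E t * (z * ((RtoC t * z) ^ S M * RtoC (/ INR (fact (S M)))))))%C).
assert (hd : forall t, is_Cderive (fun s => E s * T s)%C t (dH t)).
{ intros t. eapply is_Cderive_eq.
  - apply is_Cderive_mult; [apply is_Cderive_exp_affine | apply is_Cderive_taylor].
  - unfold dH, T, Ctaylor. rewrite Csum_Sn. fold (E t). ring. }
assert (hbd : Cmod (E 1 * T 1 - E 0 * T 0) <=
    2 * (exp (Cmod z) * (Cmod z * (Cmod z ^ S M / INR (fact (S M)))))).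
{ apply (Cmod_increment_le (fun s => E s * T s)%C dH). intros t ht. split; [apply hd|].
  unfold dH. rewrite Cmod_opp, (Cmod_mult (E t)), (Cmod_mult z), Cmod_taylor_term.
  apply Rmult_le_compat; [apply Cmod_ge_0 | | |].
  - apply Rmult_le_pos; [apply Cmod_ge_0|]. rewrite <- Cmod_taylor_term. apply Cmod_ge_0.
  - unfold E. eapply Rle_trans; [apply Cmod_Cexp_le|].
    apply exp_le_mono. rewrite Cplus_0_l. eapply Rle_trans; [apply Cmod_scal_le; exact ht|].
    rewrite Cmod_opp. apply Rle_refl.
  - apply Rmult_le_compat_l; [apply Cmod_ge_0|].
    apply Rmult_le_compat_r; [left; apply Rinv_0_lt_compat, INR_fact_lt_0|].
    apply pow_incr. split; [apply Cmod_ge_0 | apply Cmod_scal_le; exact ht]. }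
replace (Cexp z - Ctaylor (S M) z)%C with (- (Cexp z * (E 1 * T 1 - E 0 * T 0)))%C.
- rewrite Cmod_opp, Cmod_mult. unfold taylor_err.
  eapply Rle_trans.
  + apply Rmult_le_compat; [apply Cmod_ge_0 | apply Cmod_ge_0 | apply Cmod_Cexp_le | exact hbd].
  + right. ring.
- unfold E, T. rewrite !Cplus_0_l, !Cmult_1_l, !Cmult_0_l, Cexp_0, Ctaylor_0, Cmult_1_l.
  assert (h : (Cexp z * Cexp (- z))%C = RtoC 1).
  { rewrite <- Cexp_plus. replace (z + - z)%C with (RtoC 0) by ring. apply Cexp_0. }
  replace (Cexp z * (Cexp (- z) * Ctaylor (S M) z - RtoC 1))%C
    with ((Cexp z * Cexp (- z)) * Ctaylor (S M) z - Cexp z)%C by ring.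
  rewrite h. ring.
Qed.

Lemma is_lim_taylor_err x : is_lim_seq (fun M => taylor_err (S M) x) 0.
Proof.
apply (is_lim_seq_incr_1 (fun M => taylor_err M x)). unfold taylor_err.
replace 0 with (2 * (exp x * exp x) * (x * 0)) by ring.
apply (is_lim_seq_scal_l (fun M => x * (x ^ M / INR (fact M))) _ (x * 0)).
apply (is_lim_seq_scal_l _ x 0).
apply is_lim_seq_Reals, cv_speed_pow_fact.
Qed.

(** * Integration over the circle *)

(** As for derivatives, continuity is a property of the two coordinates. *)
Definition Ccontinuous (f : R -> C) : Prop :=
  continuity (fun t => Re (f t)) /\ continuity (fun t => Im (f t)).

Lemma Ccontinuous_ext f g : (forall t, f t = g t) -> Ccontinuous f -> Ccontinuous g.
Proof.
intros h [h1 h2]. split; intros t;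
  (eapply continuity_pt_ext; [intros s; rewrite <- h; reflexivity|]); auto.
Qed.

Lemma Ccontinuous_const c : Ccontinuous (fun _ => c).
Proof. split; apply continuity_const; intros x y; reflexivity. Qed.

Lemma Ccontinuous_mult f g : Ccontinuous f -> Ccontinuous g ->
  Ccontinuous (fun t => f t * g t)%C.
Proof.
intros [f1 f2] [g1 g2]. split; unfold Re, Im; simpl.
- apply continuity_minus; apply continuity_mult; assumption.
- apply continuity_plus; apply continuity_mult; assumption.
Qed.

Lemma Ccontinuous_plus f g : Ccontinuous f -> Ccontinuous g ->
  Ccontinuous (fun t => f t + g t)%C.
Proof. intros [f1 f2] [g1 g2]. split; apply continuity_plus; assumption. Qed.

Lemma Ccontinuous_sum (f : nat -> R -> C) n : (forall a, Ccontinuous (f a)) ->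
  Ccontinuous (fun t => sum_n (fun a => f a t) n).
Proof.
intros h. induction n as [|n IH].
- apply (Ccontinuous_ext (f 0%nat)); [intros t; now rewrite Csum_O | apply h].
- apply (Ccontinuous_ext (fun t => sum_n (fun a => f a t) n + f (S n) t)%C);
    [intros t; now rewrite Csum_Sn|].
  now apply Ccontinuous_plus.
Qed.

Lemma Ccontinuous_Cexp f : Ccontinuous f -> Ccontinuous (fun t => Cexp (f t)).
Proof.
intros [f1 f2].
assert (he := derivable_continuous _ derivable_exp).
split; unfold Cexp, Re at 1, Im at 1; simpl; apply continuity_mult.
- apply (continuity_comp (fun t => Re (f t)) exp); assumption.
- apply (continuity_comp (fun t => Im (f t)) cos); [assumption | apply continuity_cos].
- apply (continuity_comp (fun t => Re (f t)) exp); assumption.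
- apply (continuity_comp (fun t => Im (f t)) sin); [assumption | apply continuity_sin].
Qed.

Lemma Ccontinuous_RtoC (f : R -> R) : continuity f -> Ccontinuous (fun t => RtoC (f t)).
Proof. intros h. split; [exact h | apply continuity_const; intros x y; reflexivity]. Qed.

Lemma Ccontinuous_cis (m : R) : Ccontinuous (fun t => cis (m * t)).
Proof.
assert (h : continuity (fun t => m * t)).
{ apply continuity_mult; [apply continuity_const; intros x y; reflexivity
    | apply derivable_continuous, derivable_id]. }
split.
- apply (continuity_comp (fun t => m * t) cos); [exact h | apply continuity_cos].
- apply (continuity_comp (fun t => m * t) sin); [exact h | apply continuity_sin].
Qed.

Definition is_circle_int (f : R -> C) (l : C) : Prop :=
  is_RInt (V := C_R_NormedModule) f 0 (2 * PI) l.

Lemma is_circle_int_unique f l : is_circle_int f l ->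
  RInt (V := C_R_CompleteNormedModule) f 0 (2 * PI) = l.
Proof. apply (is_RInt_unique (V := C_R_CompleteNormedModule)). Qed.

Lemma is_circle_int_coord f l :
  is_RInt (V := R_NormedModule) (fun t => Re (f t)) 0 (2 * PI) (Re l) ->
  is_RInt (V := R_NormedModule) (fun t => Im (f t)) 0 (2 * PI) (Im l) ->
  is_circle_int f l.
Proof.
intros h1 h2. destruct l as [l1 l2].
apply (is_RInt_fct_extend_pair (U := R_NormedModule) (V := R_NormedModule)); assumption.
Qed.

Lemma is_circle_int_Re f l : is_circle_int f l ->
  is_RInt (V := R_NormedModule) (fun t => Re (f t)) 0 (2 * PI) (Re l).
Proof. apply (is_RInt_fct_extend_fst (U := R_NormedModule) (V := R_NormedModule)). Qed.

Lemma is_circle_int_Im f l : is_circle_int f l ->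
  is_RInt (V := R_NormedModule) (fun t => Im (f t)) 0 (2 * PI) (Im l).
Proof. apply (is_RInt_fct_extend_snd (U := R_NormedModule) (V := R_NormedModule)). Qed.

Lemma ex_RInt_continuity f a b : continuity f -> ex_RInt (V := R_NormedModule) f a b.
Proof.
intros h. apply (ex_RInt_continuous (V := R_CompleteNormedModule)).
intros t _. apply continuity_pt_filterlim, h.
Qed.

Lemma is_circle_int_continuous f : Ccontinuous f ->
  is_circle_int f (RInt (V := C_R_CompleteNormedModule) f 0 (2 * PI)).
Proof.
intros [h1 h2].
destruct (ex_RInt_continuity _ 0 (2 * PI) h1) as [l1 hl1].
destruct (ex_RInt_continuity _ 0 (2 * PI) h2) as [l2 hl2].
assert (h : is_circle_int f (l1, l2)) by now apply is_circle_int_coord.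
now rewrite (is_circle_int_unique _ _ h).
Qed.

Lemma is_circle_int_ext f g l : (forall t, f t = g t) ->
  is_circle_int f l -> is_circle_int g l.
Proof. intros h. apply (is_RInt_ext (V := C_R_NormedModule)). intros; apply h. Qed.

Lemma is_circle_int_plus f g lf lg : is_circle_int f lf -> is_circle_int g lg ->
  is_circle_int (fun t => f t + g t)%C (lf + lg)%C.
Proof. apply (is_RInt_plus (V := C_R_NormedModule)). Qed.

Lemma is_circle_int_minus f g lf lg : is_circle_int f lf -> is_circle_int g lg ->
  is_circle_int (fun t => f t - g t)%C (lf - lg)%C.
Proof. apply (is_RInt_minus (V := C_R_NormedModule)). Qed.

Lemma is_circle_int_scal c f l : is_circle_int f l ->
  is_circle_int (fun t => c * f t)%C (c * l)%C.
Proof.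
intros h. assert (h1 := is_circle_int_Re _ _ h). assert (h2 := is_circle_int_Im _ _ h).
unfold Re, Im in *. apply is_circle_int_coord; unfold Re, Im; simpl.
- apply (is_RInt_minus (V := R_NormedModule)); apply (is_RInt_scal (V := R_NormedModule)); assumption.
- apply (is_RInt_plus (V := R_NormedModule)); apply (is_RInt_scal (V := R_NormedModule)); assumption.
Qed.

Lemma is_circle_int_sum (f : nat -> R -> C) (l : nat -> C) n :
  (forall a, is_circle_int (f a) (l a)) ->
  is_circle_int (fun t => sum_n (fun a => f a t) n) (sum_n l n).
Proof.
intros h. induction n as [|n IH].
- rewrite Csum_O. apply (is_circle_int_ext (f 0%nat)); [intros t; now rewrite Csum_O | apply h].
- rewrite Csum_Sn. apply (is_circle_int_ext (fun t => sum_n (fun a => f a t) n + f (S n) t)%C);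
    [intros t; now rewrite Csum_Sn|].
  now apply is_circle_int_plus.
Qed.

Lemma Cmod_circle_int_le f l B : (forall t, Cmod (f t) <= B) ->
  is_circle_int f l -> Cmod l <= 2 * PI * B.
Proof.
intros hB h.
assert (hn : forall z : C, norm (V := C_R_NormedModule) z = Cmod z).
{ intros z. change (sqrt (Rabs (fst z) ^ 2 + Rabs (snd z) ^ 2) = Cmod z).
  now rewrite !pow2_abs. }
rewrite <- hn. replace (2 * PI) with (2 * PI - 0) by ring.
apply (norm_RInt_le_const (V := C_R_NormedModule) f); [generalize PI_RGT_0; lra | | exact h].
intros t _. rewrite hn. apply hB.
Qed.

Lemma is_circle_int_cis (m : Z) :
  is_circle_int (fun t => cis (IZR m * t))
    (if Z.eq_dec m 0 then RtoC (2 * PI) else RtoC 0).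
Proof.
destruct (Z.eq_dec m 0) as [->|hm].
- apply (is_circle_int_ext (fun _ => RtoC 1)).
  + intros t. now rewrite Rmult_0_l, cis_0.
  + replace (RtoC (2 * PI)) with (scal (V := C_R_NormedModule) (2 * PI - 0) (RtoC 1)).
    * apply (is_RInt_const (V := C_R_NormedModule)).
    * apply C_ext; [change ((2 * PI - 0) * 1 = 2 * PI) | change ((2 * PI - 0) * 0 = 0)]; ring.
- assert (hm' : IZR m <> 0) by now apply not_0_IZR.
  assert (hc : cis (IZR m * (2 * PI)) = RtoC 1).
  { assert (hn : forall n, cis (INR n * (2 * PI)) = RtoC 1).
    { intros n. rewrite <- Cpow_cis. unfold cis. rewrite cos_2PI, sin_2PI. apply Cpow_1_l. }
    destruct (Z_le_gt_dec 0 m) as [h|h].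
    - rewrite <- (Z2Nat.id m h), <- INR_IZR_INZ. apply hn.
    - replace (IZR m * (2 * PI)) with (- (INR (Z.to_nat (- m)) * (2 * PI))).
      + rewrite <- Cinv_cis, hn. apply C_ext; simpl; field.
      + rewrite INR_IZR_INZ, Z2Nat.id, opp_IZR by lia. ring. }
  injection hc as hcos hsin.
  apply is_circle_int_coord; simpl.
  + replace 0 with (minus (G := R_AbelianGroup) (sin (IZR m * (2 * PI)) / IZR m) (sin (IZR m * 0) / IZR m)) at 2.
    * apply (is_RInt_derive (V := R_CompleteNormedModule) (fun t => sin (IZR m * t) / IZR m)).
      -- intros x _. auto_derive; trivial. field. exact hm'.
      -- intros x _. apply continuity_pt_filterlim, (proj1 (Ccontinuous_cis (IZR m))).
    * change (sin (IZR m * (2 * PI)) / IZR m + - (sin (IZR m * 0) / IZR m) = 0).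
      rewrite hsin, Rmult_0_r, sin_0. field. exact hm'.
  + replace 0 with (minus (G := R_AbelianGroup) (- cos (IZR m * (2 * PI)) / IZR m) (- cos (IZR m * 0) / IZR m)) at 2.
    * apply (is_RInt_derive (V := R_CompleteNormedModule) (fun t => - cos (IZR m * t) / IZR m)).
      -- intros x _. auto_derive; trivial. field. exact hm'.
      -- intros x _. apply continuity_pt_filterlim, (proj2 (Ccontinuous_cis (IZR m))).
    * change (- cos (IZR m * (2 * PI)) / IZR m + - (- cos (IZR m * 0) / IZR m) = 0).
      rewrite hcos, Rmult_0_r, cos_0. field. exact hm'.
Qed.

(** * The density acts on characters by truncation *)

(** The Herglotz density as a trigonometric polynomial in the angle: [w] is the
    factor multiplying the point of the circle in the density. *)
Definition density (N : nat) (w : C) (t : R) : C :=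
  (RtoC (/ (2 * PI)) * sum_sym N (fun m => CpowZ w m * cis (IZR m * t)))%C.

Lemma Ccontinuous_density N w : Ccontinuous (density N w).
Proof.
apply Ccontinuous_mult; [apply Ccontinuous_const|].
apply (Ccontinuous_sum (fun j t => CpowZ w (Z.of_nat j - Z.of_nat N) * cis (IZR (Z.of_nat j - Z.of_nat N) * t))%C).
intros a. apply Ccontinuous_mult; [apply Ccontinuous_const | apply Ccontinuous_cis].
Qed.

Lemma density_bounded N w : exists K, forall t, Cmod (density N w t) <= K.
Proof.
exists (/ (2 * PI) * sum_f_R0 (fun j => Cmod (CpowZ w (Z.of_nat j - Z.of_nat N))) (2 * N)).
intros t. unfold density. rewrite Cmod_mult, Cmod_R.
assert (hpi : 0 < / (2 * PI)) by (apply Rinv_0_lt_compat; generalize PI_RGT_0; lra).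
rewrite Rabs_pos_eq by lra. apply Rmult_le_compat_l; [lra|].
unfold sum_sym. eapply Rle_trans; [apply Cmod_sum_n|].
apply sum_Rle. intros j _. rewrite Cmod_mult, Cmod_cis, Rmult_1_r. apply Rle_refl.
Qed.

(** Orthogonality of characters: integration against the density evaluates a
    character of frequency n at the point 1/w of the punctured plane when
    |n| <= N, and kills it otherwise. *)
Lemma circle_int_density N w (n : Z) :
  is_circle_int (fun t => cis (IZR n * t) * density N w t)%C
    (if Z_le_dec (Z.abs n) (Z.of_nat N) then CpowZ w (- n) else RtoC 0).
Proof.
assert (hpi : RtoC (2 * PI) <> RtoC 0).
{ intros h. apply RtoC_inj in h. generalize PI_RGT_0. lra. }
set (c := fun j => (RtoC (/ (2 * PI)) * CpowZ w (Z.of_nat j - Z.of_nat N))%C).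
set (l := fun j => (c j * (if Z.eq_dec (n + (Z.of_nat j - Z.of_nat N)) 0
                           then RtoC (2 * PI) else RtoC 0))%C).
assert (hint : is_circle_int (fun t => cis (IZR n * t) * density N w t)%C (sum_n l (2 * N))).
{ apply (is_circle_int_ext (fun t => sum_n (fun j =>
     c j * cis (IZR (n + (Z.of_nat j - Z.of_nat N)) * t))%C (2 * N))).
  - intros t. unfold density, sum_sym. rewrite <- !Csum_scal. apply Csum_ext.
    intros j. rewrite plus_IZR, Rmult_plus_distr_r, cis_plus. unfold c. Cring.
  - apply is_circle_int_sum. intros j. apply is_circle_int_scal, is_circle_int_cis. }
replace (if Z_le_dec (Z.abs n) (Z.of_nat N) then CpowZ w (- n) else RtoC 0)
  with (sum_n l (2 * N)); [exact hint|].
assert (hz : forall j, (n + (Z.of_nat j - Z.of_nat N) <> 0)%Z -> l j = RtoC 0).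
{ intros j hj. unfold l. destruct (Z.eq_dec _ _) as [e|_]; [contradiction | ring]. }
destruct (Z_le_dec (Z.abs n) (Z.of_nat N)) as [h|h].
- rewrite (Csum_single l _ (Z.to_nat (Z.of_nat N - n))) by (intros i hi; apply hz; lia).
  destruct (le_dec _ _) as [_|h']; [|lia].
  unfold l, c. rewrite Z2Nat.id by lia.
  destruct (Z.eq_dec _ _) as [_|e]; [|lia].
  replace (Z.of_nat N - n - Z.of_nat N)%Z with (- n)%Z by ring.
  rewrite RtoC_inv by (generalize PI_RGT_0; lra). Ceq. field. exact hpi.
- destruct (Z_le_dec n (Z.of_nat N)) as [h1|h1].
  + rewrite (Csum_single l _ (Z.to_nat (Z.of_nat N - n))) by (intros i hi; apply hz; lia).
    destruct (le_dec _ _) as [h2|_]; [lia | reflexivity].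
  + rewrite (Csum_single l _ (S (2 * N))) by (intros i hi; apply hz; lia).
    destruct (le_dec _ _) as [h2|_]; [lia | reflexivity].
Qed.

(** The integrand is a finite double sum of characters, and the error consists of
    the terms of T(al w) T(be / w) whose frequency j + b - a exceeds N in absolute
    value.  As |j| <= 1, such a term has a + b >= N, so multiplying it by
    lam^(a + b - N) can only increase it; the sum over all a, b is then dominated
    by a product of two exponentials. *)
Lemma circle_int_Ctaylor N M w (al be : C) (j : Z) (lam : R) :
  w <> RtoC 0 -> 1 <= lam -> (Z.abs j <= 1)%Z ->
  exists l, is_circle_int (fun t => cis (IZR j * t) *
     (Ctaylor M (al * cis (- t)) * Ctaylor M (be * cis t)) * density N w t)%C l /\
   Cmod (l - CpowZ w (- j) * (Ctaylor M (al * w) * Ctaylor M (be * / w))) <=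
   Cmod (CpowZ w (- j)) * (/ lam ^ N * exp (lam * (Cmod (al * w) + Cmod (be * / w)))).
Proof.
intros hw hlam hj.
set (ca := fun a => (al ^ a * RtoC (/ INR (fact a)))%C).
set (cb := fun b => (be ^ b * RtoC (/ INR (fact b)))%C).
set (n := fun a b => (j + (Z.of_nat b - Z.of_nat a))%Z).
set (la := fun a b => (ca a * cb b * (if Z_le_dec (Z.abs (n a b)) (Z.of_nat N)
                           then CpowZ w (- n a b) else RtoC 0))%C).
exists (sum_n (fun a => sum_n (la a) M) M). split.
- apply (is_circle_int_ext (fun t => sum_n (fun a => sum_n (fun b =>
     ca a * cb b * (cis (IZR (n a b) * t) * density N w t))%C M) M)).
  + intros t. unfold Ctaylor. rewrite Csum_mult.
    rewrite <- Cmult_assoc, (Cmult_comm (sum_n _ M)), Cmult_assoc.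
    rewrite <- Csum_scal. apply Csum_ext. intros a.
    rewrite <- Csum_scal. apply Csum_ext. intros b.
    rewrite !Cpow_mult_l, !Cpow_cis. unfold n, ca, cb.
    replace (IZR (j + (Z.of_nat b - Z.of_nat a)) * t)
      with (IZR j * t + (INR b * t + INR a * - t))
      by (rewrite plus_IZR, minus_IZR, <- !INR_IZR_INZ; ring).
    rewrite !cis_plus. Cring.
  + apply is_circle_int_sum. intros a. apply is_circle_int_sum. intros b.
    apply is_circle_int_scal, circle_int_density.
- set (P := Cmod (al * w)). set (Q := Cmod (be * / w)). set (K := Cmod (CpowZ w (- j))).
  assert (hP : 0 <= P) by apply Cmod_ge_0. assert (hQ : 0 <= Q) by apply Cmod_ge_0.
  assert (hlN : 0 < lam ^ N) by (apply pow_lt; lra).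
  assert (hpow : forall a b, CpowZ w (- n a b) = (CpowZ w (- j) * w ^ a * (/ w) ^ b)%C).
  { intros a b. unfold n.
    replace (- (j + (Z.of_nat b - Z.of_nat a)))%Z with ((- j + Z.of_nat a) - Z.of_nat b)%Z by ring.
    rewrite CpowZ_sub_nat, CpowZ_add_nat by exact hw. reflexivity. }
  replace (CpowZ w (- j) * (Ctaylor M (al * w) * Ctaylor M (be * / w)))%C
    with (sum_n (fun a => sum_n (fun b => ca a * cb b * CpowZ w (- n a b))%C M) M).
  2: { unfold Ctaylor. rewrite Csum_mult, <- Csum_scal. apply Csum_ext. intros a.
       rewrite <- Csum_scal. apply Csum_ext. intros b. rewrite hpow, !Cpow_mult_l.
       unfold ca, cb. Cring. }
  rewrite Csum_minus.
  eapply Rle_trans; [apply Cmod_sum_n|].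
  apply Rle_trans with (sum_f_R0 (fun a => sum_f_R0 (fun b =>
      (K * / lam ^ N * ((lam * P) ^ a / INR (fact a))) * ((lam * Q) ^ b / INR (fact b))) M) M).
  + apply sum_Rle. intros a _. rewrite Csum_minus.
    eapply Rle_trans; [apply Cmod_sum_n|]. apply sum_Rle. intros b _.
    assert (hnn : 0 <= K * / lam ^ N * ((lam * P) ^ a / INR (fact a)) * ((lam * Q) ^ b / INR (fact b))).
    { assert (0 <= K) by apply Cmod_ge_0.
      assert (0 < / lam ^ N) by now apply Rinv_0_lt_compat.
      repeat apply Rmult_le_pos; try lra; try (apply pow_le; nra);
        left; apply Rinv_0_lt_compat, INR_fact_lt_0. }
    unfold la. destruct (Z_le_dec _ _) as [h|h].
    * match goal with |- Cmod ?z <= _ => replace z with (RtoC 0) by ring end.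
      now rewrite Cmod_0.
    * replace (ca a * cb b * RtoC 0 - ca a * cb b * CpowZ w (- n a b))%C
        with (- (CpowZ w (- j) * (((al * w) ^ a * RtoC (/ INR (fact a)))
               * ((be * / w) ^ b * RtoC (/ INR (fact b))))))%C
        by (rewrite hpow, !Cpow_mult_l; unfold ca, cb; ring).
      rewrite Cmod_opp, 2 Cmod_mult, !Cmod_taylor_term. fold P Q K.
      (* outside the truncation |j + b - a| > N, and |j| <= 1 gives a + b >= N *)
      assert (hl : lam ^ N <= lam ^ a * lam ^ b).
      { rewrite <- pow_add. apply Rle_pow; [exact hlam|]. unfold n in h. lia. }
      assert (h1 : 1 <= / lam ^ N * (lam ^ a * lam ^ b)).
      { apply Rmult_le_reg_l with (lam ^ N); [exact hlN|].
        rewrite <- Rmult_assoc, Rinv_r by lra. lra. }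
      rewrite !Rpow_mult_distr.
      set (X := P ^ a / INR (fact a) * (Q ^ b / INR (fact b))).
      replace (K * / lam ^ N * (lam ^ a * P ^ a / INR (fact a)) * (lam ^ b * Q ^ b / INR (fact b)))
        with ((/ lam ^ N * (lam ^ a * lam ^ b)) * (K * X)).
      2: { unfold X. field. repeat split; try apply INR_fact_neq_0; try lra. }
      assert (0 <= K * X).
      { apply Rmult_le_pos; [apply Cmod_ge_0|]. unfold X.
        repeat apply Rmult_le_pos; try (now apply pow_le);
          left; apply Rinv_0_lt_compat, INR_fact_lt_0. }
      nra.
  + rewrite sum_f_R0_prod, Rmult_plus_distr_l, exp_plus.
    rewrite <- (Rmult_assoc K), <- (Rmult_assoc (K * / lam ^ N)).
    rewrite (sum_eq (fun a => K * / lam ^ N * ((lam * P) ^ a / INR (fact a)))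
       (fun a => ((lam * P) ^ a / INR (fact a)) * (K * / lam ^ N))) by (intros; ring).
    rewrite <- scal_sum.
    assert (0 <= K * / lam ^ N).
    { apply Rmult_le_pos; [apply Cmod_ge_0 | left; now apply Rinv_0_lt_compat]. }
    assert (hs : forall x, 0 <= x -> 0 <= sum_f_R0 (fun a => x ^ a / INR (fact a)) M).
    { intros x hx. apply cond_pos_sum. intros i.
      apply Rmult_le_pos; [now apply pow_le | left; apply Rinv_0_lt_compat, INR_fact_lt_0]. }
    apply Rmult_le_compat; [| apply hs; nra | | apply exp_ge_taylor; nra].
    * apply Rmult_le_pos; [assumption | apply hs; nra].
    * apply Rmult_le_compat_l; [assumption | apply exp_ge_taylor; nra].
Qed.

Lemma exp_prod_taylor_err M (u v : C) :
  Cmod (Cexp (u + v) - Ctaylor (S M) u * Ctaylor (S M) v) <=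
  exp (Cmod u) * taylor_err (S M) (Cmod v) + taylor_err (S M) (Cmod u) * exp (Cmod v).
Proof.
rewrite Cexp_plus.
replace (Cexp u * Cexp v - Ctaylor (S M) u * Ctaylor (S M) v)%C with
  (Cexp u * (Cexp v - Ctaylor (S M) v) + (Cexp u - Ctaylor (S M) u) * Ctaylor (S M) v)%C by ring.
eapply Rle_trans; [apply Cmod_triangle|].
rewrite !Cmod_mult.
apply Rplus_le_compat; apply Rmult_le_compat; try apply Cmod_ge_0.
- apply Cmod_Cexp_le.
- apply Ctaylor_remainder.
- apply Ctaylor_remainder.
- apply Cmod_Ctaylor_le.
Qed.

Lemma is_lim_exp_prod_taylor_err x y :
  is_lim_seq (fun M => exp x * taylor_err (S M) y + taylor_err (S M) x * exp y) 0.
Proof.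
replace 0 with (exp x * 0 + 0 * exp y) by ring.
apply (is_lim_seq_plus' _ _ (exp x * 0) (0 * exp y)).
- apply (is_lim_seq_scal_l (fun M => taylor_err (S M) y) (exp x) 0).
  apply is_lim_taylor_err.
- apply (is_lim_seq_scal_r (fun M => taylor_err (S M) x) (exp y) 0).
  apply is_lim_taylor_err.
Qed.

(** The bound for Taylor polynomials does not depend on their degree, and they
    converge uniformly on the circle because the arguments al e^(-it) and
    be e^(it) have constant modulus; so the bound passes to the limit. *)
Lemma circle_int_Cexp N w (al be : C) (j : Z) (lam : R) (l : C) :
  w <> RtoC 0 -> 1 <= lam -> (Z.abs j <= 1)%Z ->
  is_circle_int (fun t => cis (IZR j * t) *
     Cexp (al * cis (- t) + be * cis t) * density N w t)%C l ->
  Cmod (l - CpowZ w (- j) * Cexp (al * w + be * / w)) <=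
   Cmod (CpowZ w (- j)) * (/ lam ^ N * exp (lam * (Cmod (al * w) + Cmod (be * / w)))).
Proof.
intros hw hlam hj hl.
destruct (density_bounded N w) as [K hK].
assert (hK0 : 0 <= K) by (eapply Rle_trans; [apply Cmod_ge_0 | apply (hK 0)]).
set (B := Cmod (CpowZ w (- j)) * _).
set (e1 := fun M => exp (Cmod al) * taylor_err (S M) (Cmod be) + taylor_err (S M) (Cmod al) * exp (Cmod be)).
set (p := (al * w)%C). set (q := (be * / w)%C).
set (e2 := fun M => exp (Cmod p) * taylor_err (S M) (Cmod q) + taylor_err (S M) (Cmod p) * exp (Cmod q)).
assert (hlim : is_lim_seq (fun M => B + (2 * PI * K * e1 M + Cmod (CpowZ w (- j)) * e2 M)) B).
{ replace (Finite B) with (Finite (B + (2 * PI * K * 0 + Cmod (CpowZ w (- j)) * 0)))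
    by (f_equal; ring).
  apply is_lim_seq_plus'; [apply is_lim_seq_const|].
  apply is_lim_seq_plus'.
  - apply (is_lim_seq_scal_l e1 _ 0), is_lim_exp_prod_taylor_err.
  - apply (is_lim_seq_scal_l e2 _ 0), is_lim_exp_prod_taylor_err. }
refine (is_lim_seq_le (fun _ => _) _ _ _ _ (is_lim_seq_const _) hlim).
intros M.
destruct (circle_int_Ctaylor N (S M) w al be j lam hw hlam hj) as [lM [hM1 hM2]].
fold B p q in hM2.
assert (h1 : Cmod (l - lM) <= 2 * PI * (e1 M * K)).
{ eapply Cmod_circle_int_le.
  2: { exact (is_circle_int_minus _ _ _ _ hl hM1). }
  cbv beta. intros t.
  replace (cis (IZR j * t) * Cexp (al * cis (- t) + be * cis t) * density N w t -
    (cis (IZR j * t) * (Ctaylor (S M) (al * cis (- t)) * Ctaylor (S M) (be * cis t)) *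
      density N w t))%C with
   (cis (IZR j * t) * ((Cexp (al * cis (- t) + be * cis t)
      - Ctaylor (S M) (al * cis (- t)) * Ctaylor (S M) (be * cis t)) * density N w t))%C.
  2: { ring. }
  rewrite !Cmod_mult, Cmod_cis, Rmult_1_l.
  apply Rmult_le_compat; [apply Cmod_ge_0 | apply Cmod_ge_0 | | apply hK].
  eapply Rle_trans; [apply exp_prod_taylor_err|].
  rewrite !Cmod_mult, !Cmod_cis, !Rmult_1_r. apply Rle_refl. }
replace (l - CpowZ w (- j) * Cexp (p + q))%C with
  ((lM - CpowZ w (- j) * (Ctaylor (S M) p * Ctaylor (S M) q)) + ((l - lM) +
   CpowZ w (- j) * - (Cexp (p + q) - Ctaylor (S M) p * Ctaylor (S M) q)))%C by ring.
eapply Rle_trans; [apply Cmod_triangle|]. apply Rplus_le_compat; [exact hM2|].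
eapply Rle_trans; [apply Cmod_triangle|]. apply Rplus_le_compat.
- eapply Rle_trans; [exact h1 | right; ring].
- rewrite Cmod_mult, Cmod_opp. apply Rmult_le_compat_l; [apply Cmod_ge_0|].
  apply exp_prod_taylor_err.
Qed.

(** * Differentiation under the integral sign *)

Lemma Cexp_Ci (r : R) : Cexp (Ci * RtoC r) = cis r.
Proof.
apply C_ext; unfold Cexp, cis, Re, Im; simpl;
  rewrite !Rmult_0_l, !Rmult_1_l, ?Rmult_0_r, Rminus_0_r, exp_0, ?Rplus_0_l; ring.
Qed.

Lemma continuity_2d_snd (f : R -> R) x t : continuity f -> continuity_2d_pt (fun _ v => f v) x t.
Proof.
intros h. apply (continuity_1d_2d_pt_comp f (fun _ v => v)); [apply h | apply continuity_2d_pt_id2].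
Qed.

Lemma is_derive_RInt_oscillatory (a b p q : R -> R) (c d x : R) :
  continuity a -> continuity b -> continuity p -> continuity q ->
  is_derive (fun x => RInt (V := R_CompleteNormedModule)
       (fun t => cos (a t + x * b t) * p t - sin (a t + x * b t) * q t) c d) x
    (RInt (V := R_CompleteNormedModule)
       (fun t => - b t * (sin (a t + x * b t) * p t + cos (a t + x * b t) * q t)) c d).
Proof.
intros ha hb hp hq.
set (f := fun x t => cos (a t + x * b t) * p t - sin (a t + x * b t) * q t).
set (df := fun x t => - b t * (sin (a t + x * b t) * p t + cos (a t + x * b t) * q t)).
assert (hd : forall x t, is_derive (fun z => f z t) x (df x t)).
{ intros z t. unfold f, df. auto_derive; trivial. ring. }
change (is_derive (fun z => RInt (fun t => f z t) c d) x (RInt (fun t => df x t) c d)).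
rewrite <- (RInt_ext (V := R_CompleteNormedModule) (fun t => Derive (fun z => f z t) x)).
2: { intros t _. apply is_derive_unique, hd. }
apply (is_derive_RInt_param f c d x).
- apply filter_forall. intros z t _. exists (df z t). apply hd.
- intros t _. apply (continuity_2d_pt_ext df).
  + intros u v. symmetry. apply is_derive_unique, hd.
  + assert (hph : continuity_2d_pt (fun u v => a v + u * b v) x t).
    { apply continuity_2d_pt_plus; [now apply continuity_2d_snd|].
      apply continuity_2d_pt_mult; [apply continuity_2d_pt_id1 | now apply continuity_2d_snd]. }
    apply continuity_2d_pt_mult.
    * apply continuity_2d_pt_opp. now apply continuity_2d_snd.
    * apply continuity_2d_pt_plus; apply continuity_2d_pt_mult;
        try (now apply continuity_2d_snd).
      -- apply (continuity_1d_2d_pt_comp sin); [apply continuity_sin | exact hph].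
      -- apply (continuity_1d_2d_pt_comp cos); [apply continuity_cos | exact hph].
- apply filter_forall. intros z. apply ex_RInt_continuity.
  assert (hph : continuity (fun v => a v + z * b v)).
  { apply continuity_plus; [assumption|].
    apply continuity_mult; [apply continuity_const; intros ? ?; reflexivity | assumption]. }
  apply continuity_minus; apply continuity_mult; try assumption.
  + apply (continuity_comp _ cos); [exact hph | apply continuity_cos].
  + apply (continuity_comp _ sin); [exact hph | apply continuity_sin].
Qed.

Lemma is_Cderive_circle_int (a b : R -> R) (g : R -> C) (F : R -> C) (x : R) (l : C) :
  continuity a -> continuity b -> Ccontinuous g ->
  (forall x, is_circle_int (fun t => cis (a t + x * b t) * g t)%C (F x)) ->
  is_circle_int (fun t => Ci * RtoC (b t) * (cis (a t + x * b t) * g t))%C l ->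
  is_Cderive F x l.
Proof.
intros ha hb [hg1 hg2] hF hl.
split.
- apply (is_derive_ext (fun x => RInt (V := R_CompleteNormedModule)
    (fun t => cos (a t + x * b t) * Re (g t) - sin (a t + x * b t) * Im (g t)) 0 (2 * PI))).
  + intros z. apply (is_RInt_unique (V := R_CompleteNormedModule)).
    exact (is_circle_int_Re _ _ (hF z)).
  + replace (Re l) with (RInt (V := R_CompleteNormedModule) (fun t => - b t *
      (sin (a t + x * b t) * Re (g t) + cos (a t + x * b t) * Im (g t))) 0 (2 * PI)).
    * now apply is_derive_RInt_oscillatory.
    * rewrite <- (is_RInt_unique (V := R_CompleteNormedModule) _ _ _ _ (is_circle_int_Re _ _ hl)).
      apply RInt_ext. intros t _. unfold cis, Re, Im; simpl.
      match goal with |- ?u = ?v => change (@eq R u v) end. ring.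
- apply (is_derive_ext (fun x => RInt (V := R_CompleteNormedModule)
    (fun t => cos (a t + x * b t) * Im (g t) - sin (a t + x * b t) * - Re (g t)) 0 (2 * PI))).
  + intros z. rewrite <- (is_RInt_unique (V := R_CompleteNormedModule) _ _ _ _ (is_circle_int_Im _ _ (hF z))).
    apply RInt_ext. intros t _. unfold cis, Re, Im; simpl.
    match goal with |- ?u = ?v => change (@eq R u v) end. ring.
  + replace (Im l) with (RInt (V := R_CompleteNormedModule) (fun t => - b t *
      (sin (a t + x * b t) * Im (g t) + cos (a t + x * b t) * - Re (g t))) 0 (2 * PI)).
    * apply (is_derive_RInt_oscillatory a b (fun t => Im (g t)) (fun t => - Re (g t))); try assumption.
      now apply continuity_opp.
    * rewrite <- (is_RInt_unique (V := R_CompleteNormedModule) _ _ _ _ (is_circle_int_Im _ _ hl)).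
      apply RInt_ext. intros t _. unfold cis, Re, Im; simpl.
      match goal with |- ?u = ?v => change (@eq R u v) end. ring.
Qed.

Lemma CDerive_unique f x l : is_Cderive f x l -> CDerive f x = l.
Proof.
intros [h1 h2]. unfold CDerive. apply C_ext; simpl; apply is_derive_unique; assumption.
Qed.

(** * The Herglotz wave and its gradient *)

(** The density at phi is a symmetric sum of powers of [ratio * phi].  By
    k^2 = (s + tau) (s - tau), with s = sqrt (tau^2 + k^2), this number is
    i (s - tau) / k times the conjugate of omega, and its inverse is
    - i (s + tau) / k times omega. *)
Definition ratio (tau k : R) (omega : C) : C :=
  ((Ci * RtoC k) / (RtoC (tau + sqrt (tau ^ 2 + k ^ 2)) * omega))%C.

Lemma sqrt_bounds tau k : 0 < tau -> 0 < k ->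
  let s := sqrt (tau ^ 2 + k ^ 2) in
  s * s = tau ^ 2 + k ^ 2 /\ tau <= s /\ k <= s /\ s <= tau + k.
Proof.
intros ht hk s.
assert (hs : s * s = tau ^ 2 + k ^ 2) by (apply sqrt_sqrt; nra).
assert (hs0 : 0 <= s) by apply sqrt_pos.
repeat split; nra.
Qed.

Lemma unit_neq_0 omega : Cmod omega = 1 -> omega <> RtoC 0.
Proof. intros h. apply Cmod_gt_0. lra. Qed.

Lemma ratio_alt tau k omega : 0 < tau -> 0 < k -> Cmod omega = 1 ->
  ratio tau k omega =
    (Ci * RtoC ((sqrt (tau ^ 2 + k ^ 2) - tau) / k) * Cconj omega)%C.
Proof.
intros ht hk ho. destruct (sqrt_bounds tau k ht hk) as [hs [h1 [h2 h3]]].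
unfold ratio. set (s := sqrt _) in *.
assert (hA : RtoC (tau + s) <> RtoC 0) by (intros h; apply RtoC_inj in h; lra).
assert (hk2 : (tau + s) * ((s - tau) / k) = k).
{ replace ((tau + s) * ((s - tau) / k)) with ((s * s - tau ^ 2) / k) by (field; lra).
  rewrite hs. field. lra. }
assert (hoo : (omega * Cconj omega)%C = RtoC 1).
{ rewrite <- Cmod2_conj, ho. now rewrite pow1. }
replace (Ci * RtoC k)%C with
  (RtoC (tau + s) * omega * (Ci * RtoC ((s - tau) / k) * Cconj omega))%C.
- generalize (unit_neq_0 _ ho). intros ho'. field. now split.
- replace (RtoC (tau + s) * omega * (Ci * RtoC ((s - tau) / k) * Cconj omega))%C
    with (Ci * RtoC ((tau + s) * ((s - tau) / k)) * (omega * Cconj omega))%C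
    by (rewrite RtoC_mult; ring).
  rewrite hk2, hoo. ring.
Qed.

Lemma ratio_inv tau k omega : 0 < tau -> 0 < k -> Cmod omega = 1 ->
  (/ ratio tau k omega)%C =
    (- Ci * RtoC ((tau + sqrt (tau ^ 2 + k ^ 2)) / k) * omega)%C.
Proof.
intros ht hk ho. destruct (sqrt_bounds tau k ht hk) as [hs [h1 [h2 h3]]].
unfold ratio. set (s := sqrt _) in *.
assert (hA : RtoC (tau + s) <> RtoC 0) by (intros h; apply RtoC_inj in h; lra).
assert (hkC : RtoC k <> RtoC 0) by (intros h; apply RtoC_inj in h; lra).
assert (hi : Ci <> RtoC 0) by (intros h; injection h; lra).
rewrite RtoC_div by lra.
replace (- Ci)%C with (/ Ci)%C.
- field. repeat split; try assumption; now apply unit_neq_0.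
- apply C_ext; simpl; field.
Qed.

Lemma ratio_neq_0 tau k omega : 0 < tau -> 0 < k -> Cmod omega = 1 -> ratio tau k omega <> RtoC 0.
Proof.
intros ht hk ho. destruct (sqrt_bounds tau k ht hk) as [hs [h1 [h2 h3]]].
rewrite ratio_alt by assumption.
apply Cmod_gt_0. rewrite !Cmod_mult, Cmod_Ci, Cmod_conj, ho, Cmod_R.
assert (0 < (sqrt (tau ^ 2 + k ^ 2) - tau) / k).
{ apply Rdiv_lt_0_compat; [|exact hk]. nra. }
rewrite Rabs_pos_eq; lra.
Qed.

Lemma Cmod_ratio_pow_le tau k omega j : 0 < tau -> 0 < k -> Cmod omega = 1 -> (Z.abs j <= 1)%Z ->
  Cmod (CpowZ (ratio tau k omega) (- j)) <= (tau + sqrt (tau ^ 2 + k ^ 2)) / k.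
Proof.
intros ht hk ho hj. destruct (sqrt_bounds tau k ht hk) as [hs [h1 [h2 h3]]].
assert (hinv : 0 < / k) by now apply Rinv_0_lt_compat.
assert (hj' : j = 0%Z \/ j = 1%Z \/ j = (-1)%Z) by lia.
assert (e0 : forall z, CpowZ z (- 0) = RtoC 1) by reflexivity.
assert (e1 : forall z, CpowZ z (- 1) = (/ z)%C) by (intros z; simpl; now rewrite Cmult_1_r).
assert (e2 : forall z, CpowZ z (- -1) = z) by (intros z; simpl; apply Cmult_1_r).
destruct hj' as [ -> | [ -> | -> ] ]; rewrite ?e0, ?e1, ?e2.
- rewrite Cmod_1. apply Rmult_le_reg_r with k; [exact hk|].
  unfold Rdiv. rewrite Rmult_assoc, Rinv_l by lra. lra.
- rewrite ratio_inv, !Cmod_mult, Cmod_opp, Cmod_Ci, ho, Cmod_R by assumption.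
  rewrite Rabs_pos_eq; [lra|]. apply Rmult_le_pos; lra.
- rewrite ratio_alt, !Cmod_mult, Cmod_Ci, Cmod_conj, ho, Cmod_R by assumption.
  rewrite Rabs_pos_eq; [|apply Rmult_le_pos; lra].
  rewrite Rmult_1_l, Rmult_1_r. apply Rmult_le_compat_r; lra.
Qed.

(** With y read as a complex number, i k y.phi is a combination of the conjugate
    of phi and phi; these are its two coefficients. *)
Definition neg_coef (k : R) (y : C) : C := (Ci * RtoC (k / 2) * y)%C.
Definition pos_coef (k : R) (y : C) : C := (Ci * RtoC (k / 2) * Cconj y)%C.

Lemma phase_split k y t :
  (neg_coef k y * cis (- t) + pos_coef k y * cis t)%C = (Ci * RtoC (k * dot y (cis t)))%C.
Proof.
apply C_ext; unfold neg_coef, pos_coef, dot, cis; simpl; rewrite cos_neg, sin_neg; field.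
Qed.

(** Replacing phi by the inverse of [ratio] in the phase turns the plane wave into
    the exponential that is to be approximated. *)
Lemma exponent_eq tau k omega y : 0 < tau -> 0 < k -> Cmod omega = 1 ->
  (neg_coef k y * ratio tau k omega + pos_coef k y * / ratio tau k omega)%C
  = cdot y (zeta tau k omega).
Proof.
intros ht hk ho. rewrite ratio_inv, ratio_alt by assumption.
destruct y as [y1 y2], omega as [o1 o2].
apply C_ext; unfold neg_coef, pos_coef, cdot, zeta, perp; simpl; field; lra.
Qed.

(** The two terms have moduli |y| (s - tau) / 2 and |y| (s + tau) / 2. *)
Lemma exponent_size tau k omega y : 0 < tau -> 0 < k -> Cmod omega = 1 ->
  Cmod (neg_coef k y * ratio tau k omega) + Cmod (pos_coef k y * / ratio tau k omega)
  = Cmod y * sqrt (tau ^ 2 + k ^ 2).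
Proof.
intros ht hk ho. destruct (sqrt_bounds tau k ht hk) as [hs [h1 [h2 h3]]].
rewrite ratio_inv, ratio_alt by assumption.
unfold neg_coef, pos_coef.
assert (hinv : 0 < / k) by now apply Rinv_0_lt_compat.
rewrite !Cmod_mult, Cmod_opp, !Cmod_conj, Cmod_Ci, ho, !Cmod_R.
rewrite (Rabs_pos_eq (k / 2)) by lra.
rewrite !Rabs_pos_eq by (apply Rmult_le_pos; lra).
field. lra.
Qed.

(** A derivative in y multiplies the integrand by i k phi_1 or i k phi_2, which are
    combinations of e^(it) and e^(-it); so the wave and its gradient are
    expressed by the moments with j = 0, 1, -1. *)
Definition moment (N : nat) (tau k : R) (omega : C) (y : R * R) (j : Z) : C :=
  RInt (V := C_R_CompleteNormedModule)
    (fun t => cis (IZR j * t) * Cexp (Ci * RtoC (k * dot y (cis t)))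
       * density N (ratio tau k omega) t)%C 0 (2 * PI).

Lemma Ccontinuous_wave k y : Ccontinuous (fun t => Cexp (Ci * RtoC (k * dot y (cis t)))%C).
Proof.
apply Ccontinuous_Cexp, Ccontinuous_mult; [apply Ccontinuous_const|].
apply Ccontinuous_RtoC. unfold dot, cis; simpl.
assert (hc : forall c, continuity (fun _ : R => c)) by (intros c; apply continuity_const; intros ? ?; reflexivity).
apply continuity_mult; [apply hc|].
apply continuity_plus; apply continuity_mult; try apply hc;
  [apply continuity_cos | apply continuity_sin].
Qed.

Lemma is_circle_int_moment N tau k omega y j :
  is_circle_int (fun t => cis (IZR j * t) * Cexp (Ci * RtoC (k * dot y (cis t)))
       * density N (ratio tau k omega) t)%C (moment N tau k omega y j).
Proof.
apply is_circle_int_continuous.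
apply Ccontinuous_mult; [|apply Ccontinuous_density].
apply Ccontinuous_mult; [apply Ccontinuous_cis | apply Ccontinuous_wave].
Qed.

Definition moment_bound (N : nat) (tau k rad lam : R) : R :=
  (tau + sqrt (tau ^ 2 + k ^ 2)) / k *
    (/ lam ^ N * exp (lam * (rad * sqrt (tau ^ 2 + k ^ 2)))).

Lemma moment_error N tau k omega y j rad lam :
  0 < tau -> 0 < k -> Cmod omega = 1 -> 1 <= lam -> (Z.abs j <= 1)%Z -> Cmod y <= rad ->
  Cmod (moment N tau k omega y j
     - CpowZ (ratio tau k omega) (- j) * Cexp (cdot y (zeta tau k omega)))
  <= moment_bound N tau k rad lam.
Proof.
intros ht hk ho hl hj hy.
destruct (sqrt_bounds tau k ht hk) as [hs [h1 [h2 h3]]].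
rewrite <- exponent_eq by assumption.
assert (hlN : 0 < / lam ^ N) by (apply Rinv_0_lt_compat, pow_lt; lra).
eapply Rle_trans.
- apply (circle_int_Cexp N (ratio tau k omega) (neg_coef k y) (pos_coef k y) j lam);
    [now apply ratio_neq_0 | exact hl | exact hj |].
  eapply is_circle_int_ext; [|apply is_circle_int_moment].
  intros t. cbv beta. now rewrite phase_split.
- rewrite exponent_size by assumption. unfold moment_bound.
  apply Rmult_le_compat; [apply Cmod_ge_0 | | now apply Cmod_ratio_pow_le |].
  + apply Rmult_le_pos; [lra | left; apply exp_pos].
  + apply Rmult_le_compat_l; [lra|]. apply exp_le_mono.
    apply Rmult_le_compat_l; [lra|]. apply Rmult_le_compat_r; lra.
Qed.

Lemma herglotz_density_cis N tau k omega t : 0 < tau -> 0 < k -> Cmod omega = 1 ->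
  herglotz_density N (cis t) tau k omega = density N (ratio tau k omega) t.
Proof.
intros ht hk ho. destruct (sqrt_bounds tau k ht hk) as [hs [h1 [h2 h3]]].
unfold herglotz_density, density. f_equal. unfold sum_sym. apply Csum_ext. intros j.
rewrite <- CpowZ_mult_cis by now apply ratio_neq_0.
f_equal. unfold ratio. field. split; [now apply unit_neq_0|].
intros h. apply RtoC_inj in h. lra.
Qed.

Lemma herglotz_moment N tau k omega y : 0 < tau -> 0 < k -> Cmod omega = 1 ->
  herglotz N tau k omega y = moment N tau k omega y 0.
Proof.
intros ht hk ho. unfold herglotz, circle_int, moment.
apply (RInt_ext (V := C_R_CompleteNormedModule)). intros t _.
change (cos t, sin t) with (cis t).
rewrite herglotz_density_cis by assumption.
now rewrite Rmult_0_l, cis_0, Cmult_1_l.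
Qed.

Lemma is_Cderive_herglotz_1 N tau k omega y : 0 < tau -> 0 < k -> Cmod omega = 1 ->
  is_Cderive (fun x => herglotz N tau k omega (x, snd y)) (fst y)
   (Ci * RtoC (k / 2) * (moment N tau k omega y 1 + moment N tau k omega y (-1)))%C.
Proof.
intros ht hk ho.
assert (hc : forall c, continuity (fun _ : R => c)) by (intros c; apply continuity_const; intros ? ?; reflexivity).
apply (is_Cderive_circle_int (fun t => k * snd y * sin t) (fun t => k * cos t)
   (density N (ratio tau k omega))).
- apply continuity_mult; [apply hc | apply continuity_sin].
- apply continuity_mult; [apply hc | apply continuity_cos].
- apply Ccontinuous_density.
- intros x. rewrite herglotz_moment by assumption.
  eapply is_circle_int_ext; [|apply is_circle_int_moment].
  intros t. cbv beta. rewrite Rmult_0_l, cis_0, Cmult_1_l, Cexp_Ci.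
  do 2 f_equal. unfold dot, cis; simpl; ring.
- eapply is_circle_int_ext.
  2: { apply is_circle_int_scal, is_circle_int_plus; apply is_circle_int_moment. }
  intros t. cbv beta. rewrite Cexp_Ci.
  replace (k * dot y (cis t)) with (k * snd y * sin t + fst y * (k * cos t))
    by (unfold dot, cis; simpl; ring).
  replace (RtoC (k * cos t)) with (RtoC (k / 2) * (cis (1 * t) + cis (-1 * t)))%C; [ring|].
  replace (-1 * t) with (- t) by ring. rewrite Rmult_1_l.
  apply C_ext; unfold cis; simpl; rewrite cos_neg, sin_neg; field.
Qed.

Lemma is_Cderive_herglotz_2 N tau k omega y : 0 < tau -> 0 < k -> Cmod omega = 1 ->
  is_Cderive (fun x => herglotz N tau k omega (fst y, x)) (snd y)
   (RtoC (k / 2) * (moment N tau k omega y 1 - moment N tau k omega y (-1)))%C.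
Proof.
intros ht hk ho.
assert (hc : forall c, continuity (fun _ : R => c)) by (intros c; apply continuity_const; intros ? ?; reflexivity).
apply (is_Cderive_circle_int (fun t => k * fst y * cos t) (fun t => k * sin t)
   (density N (ratio tau k omega))).
- apply continuity_mult; [apply hc | apply continuity_cos].
- apply continuity_mult; [apply hc | apply continuity_sin].
- apply Ccontinuous_density.
- intros x. rewrite herglotz_moment by assumption.
  eapply is_circle_int_ext; [|apply is_circle_int_moment].
  intros t. cbv beta. rewrite Rmult_0_l, cis_0, Cmult_1_l, Cexp_Ci.
  do 2 f_equal. unfold dot, cis; simpl; ring.
- eapply is_circle_int_ext.
  2: { apply is_circle_int_scal, is_circle_int_minus; apply is_circle_int_moment. }
  intros t. cbv beta. rewrite Cexp_Ci.
  replace (k * dot y (cis t)) with (k * fst y * cos t + snd y * (k * sin t))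
    by (unfold dot, cis; simpl; ring).
  replace (Ci * RtoC (k * sin t))%C with (RtoC (k / 2) * (cis (1 * t) - cis (-1 * t)))%C; [ring|].
  replace (-1 * t) with (- t) by ring. rewrite Rmult_1_l.
  apply C_ext; unfold cis; simpl; rewrite cos_neg, sin_neg; field.
Qed.

(** The same relation between first-order moments and derivatives holds for the
    exponential, so the gradient of the error is made of moment errors. *)
Lemma zeta_ratio tau k omega : 0 < tau -> 0 < k -> Cmod omega = 1 ->
  fst (zeta tau k omega) =
    (Ci * RtoC (k / 2) * (/ ratio tau k omega + ratio tau k omega))%C /\
  snd (zeta tau k omega) =
    (RtoC (k / 2) * (/ ratio tau k omega - ratio tau k omega))%C.
Proof.
intros ht hk ho. rewrite ratio_inv, ratio_alt by assumption.
destruct omega as [o1 o2].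
split; apply C_ext; unfold zeta, perp; simpl; field; lra.
Qed.

Lemma grad_approx_error N tau k omega y : 0 < tau -> 0 < k -> Cmod omega = 1 ->
  let w := ratio tau k omega in
  let E := Cexp (cdot y (zeta tau k omega)) in
  let e1 := (moment N tau k omega y 1 - CpowZ w (- (1)) * E)%C in
  let e2 := (moment N tau k omega y (-1) - CpowZ w (- (-1)) * E)%C in
  grad (approx_error N tau k omega) y =
    ((Ci * RtoC (k / 2) * (e1 + e2))%C, (RtoC (k / 2) * (e1 - e2))%C).
Proof.
intros ht hk ho w E e1 e2.
destruct (zeta_ratio tau k omega ht hk ho) as [hz1 hz2].
unfold grad. f_equal; apply CDerive_unique; unfold approx_error.
- eapply is_Cderive_eq.
  + apply is_Cderive_minus; [now apply is_Cderive_herglotz_1|].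
    apply (is_Cderive_ext (fun s => Cexp (RtoC (snd y) * snd (zeta tau k omega)
       + RtoC s * fst (zeta tau k omega)))%C).
    * intros s. unfold cdot; simpl. f_equal. ring.
    * apply is_Cderive_exp_affine.
  + cbv beta. unfold e1, e2, E, w. unfold cdot. rewrite hz1, hz2. simpl. rewrite !Cmult_1_r.
    rewrite (Cplus_comm (RtoC (snd y) * _)). ring.
- eapply is_Cderive_eq.
  + apply is_Cderive_minus; [now apply is_Cderive_herglotz_2|].
    apply (is_Cderive_ext (fun s => Cexp (RtoC (fst y) * fst (zeta tau k omega)
       + RtoC s * snd (zeta tau k omega)))%C).
    * intros s. unfold cdot; simpl. f_equal.
    * apply is_Cderive_exp_affine.
  + cbv beta. unfold e1, e2, E, w. unfold cdot. rewrite hz1, hz2. simpl. rewrite !Cmult_1_r.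
    ring.
Qed.

Lemma C2norm_le v : C2norm v <= Cmod (fst v) + Cmod (snd v).
Proof.
unfold C2norm. assert (h1 := Cmod_ge_0 (fst v)). assert (h2 := Cmod_ge_0 (snd v)).
rewrite <- (sqrt_pow2 (Cmod (fst v) + Cmod (snd v))) by lra.
apply sqrt_le_1_alt. nra.
Qed.

Lemma approx_error_bounds N tau k omega y rad lam :
  0 < tau -> 0 < k -> Cmod omega = 1 -> 1 <= lam -> Cmod y <= rad ->
  Cmod (approx_error N tau k omega y) <= moment_bound N tau k rad lam /\
  C2norm (grad (approx_error N tau k omega) y) <= 2 * k * moment_bound N tau k rad lam.
Proof.
intros ht hk ho hl hy.
assert (h : forall j, (Z.abs j <= 1)%Z -> _) by
  (intros j hj; exact (moment_error N tau k omega y j rad lam ht hk ho hl hj hy)).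
split.
- unfold approx_error. rewrite herglotz_moment by assumption.
  generalize (h 0%Z ltac:(lia)). simpl. now rewrite Cmult_1_l.
- rewrite grad_approx_error by assumption.
  eapply Rle_trans; [apply C2norm_le|]. simpl fst; simpl snd.
  assert (h1 := h 1%Z ltac:(lia)). assert (h2 := h (-1)%Z ltac:(lia)).
  revert h1 h2.
  set (e1 := (moment N tau k omega y 1 - _)%C). set (e2 := (moment N tau k omega y (-1) - _)%C).
  intros h1 h2.
  rewrite !Cmod_mult, Cmod_Ci, !Cmod_R, Rabs_pos_eq by lra.
  assert (h3 := Cmod_triangle e1 e2).
  assert (h4 := Cmod_triangle e1 (- e2)%C). rewrite Cmod_opp in h4.
  change (e1 - e2)%C with (e1 + - e2)%C. nra.
Qed.

(** * Asymptotics *)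

Lemma sup_disc_bound rad (f : R * R -> R) (B : R) : 0 <= rad ->
  (forall y, 0 <= f y) -> (forall y, Cmod y <= rad -> f y <= B) ->
  exists b, sup_disc rad f = Finite b /\ 0 <= b <= B.
Proof.
intros hr h0 hB. unfold sup_disc.
set (S := fun v => exists y : R * R, Cmod y <= rad /\ v = f y).
destruct (Lub_Rbar_correct S) as [hub hlub].
assert (hup : Rbar_le (Lub_Rbar S) B).
{ apply hlub. intros v [y [hy ->]]. apply hB, hy. }
assert (hlo : Rbar_le (f (0, 0)) (Lub_Rbar S)).
{ apply hub. exists (0, 0). split; [|reflexivity].
  replace (Cmod (0, 0)) with 0; [exact hr | symmetry; apply Cmod_0]. }
destruct (Lub_Rbar S) as [b | |]; simpl in hup, hlo; try contradiction.
exists b. repeat split; [|exact hup]. eapply Rle_trans; [apply h0 | exact hlo].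
Qed.

Lemma decay_rate beta0 beta : is_beta0 beta0 -> 0 < beta -> beta < beta0 ->
  0 < - (beta / exp 1 + ln beta).
Proof.
intros [h0 he] hb hlt.
assert (hl := ln_increasing _ _ hb hlt).
assert (hi : 0 < / exp 1) by apply Rinv_0_lt_compat, exp_pos.
unfold Rdiv in *. nra.
Qed.

Lemma ratio_exp_ge_1 beta0 beta : is_beta0 beta0 -> 0 < beta -> beta < beta0 ->
  1 <= exp 1 / beta.
Proof.
intros h0 hb hlt. assert (hd := decay_rate _ _ h0 hb hlt).
assert (hi : 0 < beta / exp 1) by (apply Rdiv_lt_0_compat; [exact hb | apply exp_pos]).
assert (h1 : beta < 1).
{ apply ln_lt_inv; [exact hb | lra |]. rewrite ln_1. lra. }
assert (he : 1 <= exp 1) by (generalize (exp_ineq1_le 1); lra).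
apply Rmult_le_reg_r with beta; [exact hb|].
unfold Rdiv. rewrite Rmult_assoc, Rinv_l by lra. lra.
Qed.

Lemma linear_exp_decay delta M : 0 < delta -> 0 < M ->
  exists c, forall N : nat, (1 <= N)%nat ->
    INR N * exp (- (delta * INR N)) <= c * Rpower (INR N) (- M).
Proof.
intros hd hM. set (a := delta / (1 + M)).
assert (ha : 0 < a) by (apply Rdiv_lt_0_compat; lra).
exists (exp (- ((1 + M) * ln a))). intros N hN.
assert (hN' : 1 <= INR N) by (replace 1 with (INR 1) by reflexivity; now apply le_INR).
unfold Rpower. rewrite <- (exp_ln (INR N)) at 1 by lra.
rewrite <- !exp_plus. apply exp_le_mono.
(* the value of a makes (1 + M) ln (a N) at most delta N *)
assert (hln : 1 + ln (a * INR N) <= a * INR N).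
{ rewrite <- (exp_ln (a * INR N)) at 2 by (apply Rmult_lt_0_compat; lra).
  apply exp_ineq1_le. }
rewrite ln_mult in hln by lra.
assert (hda : delta = (1 + M) * a) by (unfold a; field; lra).
rewrite hda. nra.
Qed.

(** Put x = beta N / e + D.  Both rad * t and rad * s are at most x, and
    lam = e / beta turns exp (lam x) into exp (N) up to a constant, while lam^(-N)
    is beta^N exp (- N).  What remains is exp (x) beta^N, times a factor linear
    in x. *)
Lemma weighted_bound_decay rad k beta lam D t N :
  0 < rad -> 0 < k -> 0 < beta -> 0 < t -> 0 <= D -> (1 <= N)%nat ->
  lam = exp 1 / beta ->
  rad * (t + k) <= beta * INR N / exp 1 + D ->
  exp (rad * t) * ((1 + 2 * k) * moment_bound N t k rad lam) <=
  (1 + 2 * k) * (2 * (beta / exp 1 + D) / (rad * k)) * exp (D + exp 1 / beta * D) *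
    (INR N * exp (- (- (beta / exp 1 + ln beta) * INR N))).
Proof.
intros hr hk hb ht hD hN hlam hx.
destruct (sqrt_bounds t k ht hk) as [_ [h1 [h2 h3]]].
unfold moment_bound. set (s := sqrt _) in *. set (x := beta * INR N / exp 1 + D) in *.
assert (hN' : 1 <= INR N) by (replace 1 with (INR 1) by reflexivity; now apply le_INR).
assert (he : 0 < exp 1) by apply exp_pos.
assert (hl : 0 < lam) by (rewrite hlam; now apply Rdiv_lt_0_compat).
assert (hs : rad * s <= x) by nra.
assert (hbe : 0 < beta / exp 1) by now apply Rdiv_lt_0_compat.
assert (hxN : x <= (beta / exp 1 + D) * INR N).
{ unfold x. replace (beta * INR N / exp 1) with (beta / exp 1 * INR N) by (field; lra). nra. }
assert (hA : (t + s) / k <= 2 * (beta / exp 1 + D) / (rad * k) * INR N).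
{ apply Rmult_le_reg_r with (rad * k); [now apply Rmult_lt_0_compat|].
  replace ((t + s) / k * (rad * k)) with (rad * t + rad * s) by (field; lra).
  replace (2 * (beta / exp 1 + D) / (rad * k) * INR N * (rad * k))
    with (2 * ((beta / exp 1 + D) * INR N)) by (field; lra).
  nra. }
assert (hlN : / lam ^ N = exp (INR N * (ln beta - 1))).
{ rewrite <- Rpower_pow by exact hl. unfold Rpower. rewrite <- exp_Ropp. f_equal.
  rewrite hlam. unfold Rdiv. rewrite ln_mult, ln_Rinv, ln_exp by (try apply Rinv_0_lt_compat; assumption).
  ring. }
assert (hexp : exp (rad * t) * (/ lam ^ N * exp (lam * (rad * s))) <=
   exp (D + exp 1 / beta * D) * exp (- (- (beta / exp 1 + ln beta) * INR N))).
{ rewrite hlN, <- !exp_plus. apply exp_le_mono.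
  assert (hlx : lam * (rad * s) <= lam * x) by (apply Rmult_le_compat_l; lra).
  assert (hlx' : lam * x = INR N + exp 1 / beta * D).
  { rewrite hlam. unfold x. field. lra. }
  assert (rad * t <= x) by nra.
  unfold x in H. replace (beta * INR N / exp 1) with (beta / exp 1 * INR N) in H by (field; lra).
  nra. }
set (P := exp (rad * t)) in *. set (Q := / lam ^ N * exp (lam * (rad * s))) in *.
set (Z := exp (D + exp 1 / beta * D)) in *.
set (W := exp (- (- (beta / exp 1 + ln beta) * INR N))) in *.
set (V := 2 * (beta / exp 1 + D) / (rad * k)) in *.
assert (hQ : 0 <= P * Q).
{ unfold P, Q. rewrite hlN. left. repeat apply Rmult_lt_0_compat; apply exp_pos. }
assert (h0 : 0 <= (t + s) / k) by (apply Rmult_le_pos; [lra | left; now apply Rinv_0_lt_compat]).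
replace (P * ((1 + 2 * k) * ((t + s) / k * Q))) with ((1 + 2 * k) * ((t + s) / k * (P * Q))) by ring.
replace ((1 + 2 * k) * V * Z * (INR N * W)) with ((1 + 2 * k) * ((V * INR N) * (Z * W))) by ring.
apply Rmult_le_compat_l; [lra|]. now apply Rmult_le_compat.
Qed.

Theorem theorem2p1
  (rad k : R) (omega : C) (beta0 beta : R) (tau : nat -> R)
  (hrad : 0 < rad) (hk : 0 < k) (homega : Cmod omega = 1)
  (hbeta0 : is_beta0 beta0)
  (hbeta_pos : 0 < beta) (hbeta_lt : beta < beta0)
  (htau_pos : forall N : nat, (1 <= N)%nat -> 0 < tau N)
  (htau : bigO (fun N => Finite (tau N - beta * INR N / (exp 1 * rad)))
               (fun _ => 1)) :
  bigO_Ninfty (fun N =>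
    Rbar_plus
      (Rbar_mult (Finite (exp (rad * tau N)))
         (sup_disc rad (fun y => Cmod (approx_error N (tau N) k omega y))))
      (Rbar_mult (Finite (exp (rad * tau N)))
         (sup_disc rad
            (fun y => C2norm (grad (approx_error N (tau N) k omega) y))))).
Proof.
intros M hM.
set (lam := exp 1 / beta).
assert (hlam : 1 <= lam) by exact (ratio_exp_ge_1 _ _ hbeta0 hbeta_pos hbeta_lt).
destruct htau as [A [N0 hA]].
(* the k in D pays for sqrt (tau^2 + k^2) <= tau + k *)
set (D := rad * (Rabs A + k)).
assert (hD : 0 <= D) by (apply Rmult_le_pos; generalize (Rabs_pos A); lra).
destruct (linear_exp_decay _ M (decay_rate _ _ hbeta0 hbeta_pos hbeta_lt) hM) as [c hc].
set (K := (1 + 2 * k) * (2 * (beta / exp 1 + D) / (rad * k)) * exp (D + exp 1 / beta * D)).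
assert (he : 0 < exp 1) by apply exp_pos.
assert (hK : 0 <= K).
{ assert (0 < beta / exp 1) by now apply Rdiv_lt_0_compat.
  unfold K. repeat apply Rmult_le_pos; try lra.
  - left. apply Rinv_0_lt_compat. now apply Rmult_lt_0_compat.
  - left. apply exp_pos. }
exists (K * c). exists (Nat.max N0 1). intros N hN.
assert (hN1 : (1 <= N)%nat) by lia.
assert (ht := htau_pos N hN1).
assert (hAN := hA N ltac:(lia)). simpl in hAN. rewrite Rabs_R1, Rmult_1_r in hAN.
assert (hx : rad * (tau N + k) <= beta * INR N / exp 1 + D).
{ assert (h1 := Rle_trans _ _ _ (Rle_abs _) (Rle_trans _ _ _ hAN (Rle_abs A))).
  unfold D. replace (beta * INR N / exp 1) with (rad * (beta * INR N / (exp 1 * rad)))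
    by (field; lra).
  nra. }
set (B := moment_bound N (tau N) k rad lam).
assert (hb : forall y, Cmod y <= rad -> _ /\ _) by
  (intros y hy; exact (approx_error_bounds N (tau N) k omega y rad lam ht hk homega hlam hy)).
destruct (sup_disc_bound rad (fun y => Cmod (approx_error N (tau N) k omega y)) B)
  as [b1 [-> hb1]]; [lra | intros; apply Cmod_ge_0 | intros y hy; apply hb, hy |].
destruct (sup_disc_bound rad (fun y => C2norm (grad (approx_error N (tau N) k omega) y)) (2 * k * B))
  as [b2 [-> hb2]]; [lra | intros; apply sqrt_pos | intros y hy; apply hb, hy |].
simpl.
assert (hE : 0 < exp (rad * tau N)) by apply exp_pos.
rewrite Rabs_pos_eq by nra.
assert (hP : 0 < Rpower (INR N) (- M)) by apply exp_pos.
rewrite (Rabs_pos_eq (Rpower _ _)) by lra.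
apply Rle_trans with (exp (rad * tau N) * ((1 + 2 * k) * B)); [nra|].
eapply Rle_trans; [now apply (weighted_bound_decay rad k beta lam D)|].
fold K. rewrite Rmult_assoc. apply Rmult_le_compat_l; [exact hK|]. now apply hc.
Qed.
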